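(* Let $\mathscr{A}_1$ and $\mathscr{A}_2$ be $C^*$-subalgebras of a unital $C^*$-algebra $\mathscr{A}$, all three algebras having the same identity. Then $\mathscr{A}_1$ and $\mathscr{A}_2$ are $C^*$-independent if and only if for all positive norm-one elements $a_i\in\mathscr{A}_i$ ($i=1,2$) and all states $\varphi_i\in S(\mathscr{A}_i)$ with $\varphi_i(a_i)=1$ ($i=1,2$), there are extensions $\widetilde{\varphi}_i\in S(\mathscr{A})$ of $\varphi_i$ ($i=1,2$) such that $$\widetilde{\varphi}_1(z)\le\varphi_2(z^2)^{1/2}\quad(z\in\mathscr{A}_2^+)\qquad\text{and}\qquad\widetilde{\varphi}_2(z)\le\varphi_1(z^2)^{1/2}\quad(z\in\mathscr{A}_1^+).$$
   Context: A state on a $C^*$-algebra is a positive linear functional of norm one; $S(\mathscr{B})$ is the set of states of $\mathscr{B}$, and $\mathscr{B}^+$ is the set of positive elements of $\mathscr{B}$. $C^*$-independence: $C^*$-subalgebras $\mathscr{A}_1,\mathscr{A}_2$ of $\mathscr{A}$ (all with the same identity) are $C^*$-independent if for every state $\varphi_1$ of $\mathscr{A}_1$ and every state $\varphi_2$ of $\mathscr{A}_2$ there is a state $\varphi$ of $\mathscr{A}$ extending both $\varphi_1$ and $\varphi_2$. *)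

(* Defs.v *)
From HB Require Import structures.
From mathcomp Require Import all_boot all_order all_algebra.
From mathcomp Require Import complex.
From mathcomp Require Import all_classical all_reals all_analysis.

Set Implicit Arguments.
Unset Strict Implicit.
Unset Printing Implicit Defensive.

Import Order.TTheory GRing.Theory Num.Theory.
Import numFieldNormedType.Exports.

Local Open Scope classical_set_scope.
Local Open Scope complex_scope.
Local Open Scope ring_scope.

(* Scalars are the complex numbers R[i], whose order is the partial one:
   0 <= z means that z is real and nonnegative.  Norms take values in R[i]
   and are nonnegative for this order.  The multiplication is part of the
   record because no Hierarchy-Builder structure can extend both a ring and
   a normed module (the join would have to precede numDomainType); the ring
   structure is recovered below on cstar_sort. *)
Record cstarAlgebra (R : realType) := CStarAlgebra {
  cstar_banach : completeNormedModType R[i];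
  cmul : cstar_banach -> cstar_banach -> cstar_banach;
  cone : cstar_banach;
  cstar : cstar_banach -> cstar_banach;
  cmulA : associative cmul;
  cmul1x : left_id cone cmul;
  cmulx1 : right_id cone cmul;
  cmulDl : left_distributive cmul +%R;
  cmulDr : right_distributive cmul +%R;
  cscaleAl : forall (c : R[i]) x y, c *: cmul x y = cmul (c *: x) y;
  cscaleAr : forall (c : R[i]) x y, c *: cmul x y = cmul x (c *: y);
  cstarD : forall x y, cstar (x + y) = cstar x + cstar y;
  cstarZ : forall (c : R[i]) x, cstar (c *: x) = c^* *: cstar x;
  cstarM : forall x y, cstar (cmul x y) = cmul (cstar y) (cstar x);
  cstarK : involutive cstar;
  cnormM : forall x y, `|cmul x y| <= `|x| * `|y|;
  cnorm_star : forall x, `|cmul (cstar x) x| = `|x| ^+ 2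
}.

Definition cstar_sort (R : realType) (A : cstarAlgebra R) : Type :=
  cstar_banach A.
Coercion cstar_sort : cstarAlgebra >-> Sortclass.

HB.instance Definition _ (R : realType) (A : cstarAlgebra R) :=
  CompleteNormedModule.on (cstar_sort A).
HB.instance Definition _ (R : realType) (A : cstarAlgebra R) :=
  GRing.Zmodule_isPzRing.Build (cstar_sort A)
    (@cmulA R A) (@cmul1x R A) (@cmulx1 R A) (@cmulDl R A) (@cmulDr R A).

Definition star (R : realType) (A : cstarAlgebra R) (x : A) : A :=
  @cstar R A x.

Section CStar.
Context {R : realType} {A : cstarAlgebra R}.
Implicit Types (B : set A) (phi psi : A -> R[i]).

(* A C*-subalgebra with the same identity as A. *)
Record cstar_subalgebra B : Prop := CStarSubalgebra {
  cstar_sub1 : B 1;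
  cstar_subD : forall x y, B x -> B y -> B (x + y);
  cstar_subZ : forall (c : R[i]) x, B x -> B (c *: x);
  cstar_subM : forall x y, B x -> B y -> B (x * y);
  cstar_sub_star : forall x, B x -> B (star x);
  cstar_sub_closed : closed B
}.

(* The positive cone of B, with the witness y taken in B itself. *)
Definition cstar_pos B : set A := [set star y * y | y in B].

(* A functional on B is encoded by a function on A of which only the values
   on B matter; its norm is the supremum of |phi x| over the unit ball
   of B. *)
Record state_on B phi : Prop := StateOn {
  state_linear : forall (c : R[i]) (x y : A), B x -> B y ->
    phi (c *: x + y) = c * phi x + phi y;
  state_ge0 : forall x, cstar_pos B x -> 0 <= phi x;
  state_norm1 : supremums
    [set (`|phi x| : R[i]) | x in [set x | B x /\ `|x| <= 1]] (1 : R[i])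
}.

Definition extends_on B psi phi : Prop := forall x, B x -> psi x = phi x.

Definition cstar_independent (A1 A2 : set A) : Prop :=
  forall phi1 phi2, state_on A1 phi1 -> state_on A2 phi2 ->
    exists phi, [/\ state_on setT phi, extends_on A1 phi phi1
                  & extends_on A2 phi phi2].

End CStar.

(* Main.v *)
Require Import Defs.
From mathcomp Require Import all_boot all_order all_algebra.
From mathcomp Require Import complex.
From mathcomp Require Import all_classical all_reals all_analysis.
From mathcomp Require Import ring lra.

Set Implicit Arguments.
Unset Strict Implicit.
Unset Printing Implicit Defensive.

Import Order.TTheory GRing.Theory Num.Theory.
Import numFieldNormedType.Exports.

Local Open Scope classical_set_scope.
Local Open Scope complex_scope.
Local Open Scope ring_scope.

(* If a common extension phi of phi1 and phi2 exists, take both extensions equal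
   to phi and use phi(z)^2 <= phi(z^2) (Cauchy-Schwarz).

   Conversely, let a1, a2 be positive of norm one and let phi1, phi2 be states
   with phi1(a1) = phi2(a2) = 1.  Then phi2((1 - a2)^4) = 0, so the extension
   psi1 of phi1 vanishes at (1 - a2)^2, and psi1(a1) = psi1(a2) = 1.  Thus any
   two such elements are normed by a common state, and this implies that
   t + x1 + x2 >= 0 forces t + phi1(x1) + phi2(x2) >= 0 for all states phi1,
   phi2 and self-adjoint xi; the Hahn-Banach theorem then yields a common
   extension.  Positivity is handled without spectral theory, through the cone
   of self-adjoint w such that |t - w| <= t for some t >= 0; that y'y + d lies
   in it for all d > 0 (y' the adjoint of y) is Kaplansky's theorem. *)

(** * The real-valued norm *)

Section RealNorm.
Context {R : realType} {A : cstarAlgebra R}.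
Implicit Types (x y z w : A) (t : R).

(** The norm takes nonnegative real values inside [R[i]], so passing to the real part loses nothing
    and gives access to the total order of [R]. *)
Definition nrm x : R := complex.Re `|x|.

Lemma nrmE x : `|x| = (nrm x)%:C.
Proof. by rewrite /nrm RRe_real // ger0_real. Qed.

Lemma nrm_ge0 x : 0 <= nrm x.
Proof. by rewrite -ler0c -nrmE. Qed.

Lemma nrmD x y : nrm (x + y) <= nrm x + nrm y.
Proof. by rewrite -lecR rmorphD /= -!nrmE ler_normD. Qed.

Lemma nrmN x : nrm (- x) = nrm x.
Proof. by rewrite /nrm normrN. Qed.

Lemma nrmB x y : nrm (x - y) <= nrm x + nrm y.
Proof. by rewrite -(nrmN y) nrmD. Qed.

Lemma nrm0 : nrm (0 : A) = 0.
Proof. by rewrite /nrm normr0. Qed.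

Lemma nrm0_eq0 x : nrm x = 0 -> x = 0.
Proof. by move=> x0; apply/normr0_eq0; rewrite nrmE x0. Qed.

Lemma nrmZ (c : R[i]) x : nrm (c *: x) = Normc.normc c * nrm x.
Proof. by apply: complexI; rewrite rmorphM /= -!nrmE normrZ. Qed.

Lemma nrmZr t x : nrm (t%:C *: x) = `|t| * nrm x.
Proof. by rewrite nrmZ /= expr0n /= addr0 sqrtr_sqr. Qed.

Lemma nrmM x y : nrm (x * y) <= nrm x * nrm y.
Proof. by rewrite -lecR rmorphM /= -!nrmE; exact: (@cnormM R A). Qed.

Lemma nrm_starM x : nrm (star x * x) = nrm x ^+ 2.
Proof. by apply: complexI; rewrite rmorphXn /= -!nrmE; exact: (@cnorm_star R A). Qed.

Lemma starK x : star (star x) = x. Proof. exact: (@cstarK R A). Qed.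
Lemma starM x y : star (x * y) = star y * star x.
Proof. exact: (@cstarM R A). Qed.
Lemma starD x y : star (x + y) = star x + star y.
Proof. exact: (@cstarD R A). Qed.
Lemma starZ (c : R[i]) x : star (c *: x) = c^* *: star x.
Proof. exact: (@cstarZ R A). Qed.
Lemma conjE (c : R[i]) : Num.conj c = conjc c.
Proof. by []. Qed.
Lemma starZr t x : star (t%:C *: x) = t%:C *: star x.
Proof. by rewrite starZ conjE conjc_real. Qed.
Lemma starN x : star (- x) = - star x.
Proof. by rewrite -scaleN1r starZ rmorphN rmorph1 scaleN1r. Qed.
Lemma starB x y : star (x - y) = star x - star y.
Proof. by rewrite starD starN. Qed.
Lemma star1 : star (1 : A) = 1.
Proof. by rewrite -[LHS]mulr1 -{2}(starK 1) -starM mulr1 starK. Qed.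
Lemma scAl (c : R[i]) x y : (c *: x) * y = c *: (x * y).
Proof. by rewrite [RHS](@cscaleAl R A). Qed.
Lemma scAr (c : R[i]) x y : x * (c *: y) = c *: (x * y).
Proof. by rewrite [RHS](@cscaleAr R A). Qed.

Lemma nrm_star x : nrm (star x) = nrm x.
Proof.
wlog suff : x / nrm x <= nrm (star x).
  by move=> H; apply/eqP; rewrite eq_le H andbT -{2}(starK x) H.
have [x0|x0] := leP (nrm x) 0; first exact: le_trans x0 (nrm_ge0 _).
by rewrite -(ler_pM2r x0) -expr2 -nrm_starM nrmM.
Qed.

Lemma nrm_sa_sqr x : star x = x -> nrm (x * x) = nrm x ^+ 2.
Proof. by move=> sx; rewrite -nrm_starM sx. Qed.

(** The unit is a self-adjoint idempotent, so [nrm 1] equals its own square. The zero algebra is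
    allowed, hence an inequality and not an equality. *)
Lemma nrm1_le1 : nrm (1 : A) <= 1.
Proof.
have := nrm_sa_sqr star1; rewrite mulr1 => h.
have := nrm_ge0 1; nra.
Qed.

Lemma nrmZ1 t : nrm (t%:C *: (1 : A)) <= `|t|.
Proof. by rewrite nrmZr ler_piMr // nrm1_le1. Qed.

Lemma complete_geometric (u : nat -> A) (C q : R) : 0 <= q < 1 ->
  (forall n, nrm (u n.+1 - u n) <= C * q ^+ n) ->
  exists l, forall e, 0 < e -> exists N, forall n, (N <= n)%N -> nrm (u n - l) < e.
Proof.
move=> /andP[q0 q1] Hu.
have C0 : 0 <= C by have := Hu 0%N; rewrite expr0 mulr1; apply: le_trans (nrm_ge0 _).
have q1' : 0 < 1 - q by rewrite subr_gt0.
have [K K0 CK] : exists2 K, 0 <= K & C = K * (1 - q).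
  by exists (C / (1 - q)); rewrite ?divr_ge0 ?divfK ?gt_eqF // ltW.
(* The right-hand side is the geometric sum of [C * q ^+ i] for [i] from [n] to [n + k - 1], since
   [K = C / (1 - q)]. *)
have Hk n k : nrm (u (n + k)%N - u n) <= K * q ^+ n * (1 - q ^+ k).
  elim: k => [|k IH]; first by rewrite addn0 !subrr mulr0 nrm0.
  have -> : u (n + k.+1)%N - u n = (u (n + k).+1 - u (n + k)%N) + (u (n + k)%N - u n).
    by rewrite addnS addrA subrK.
  apply: le_trans (nrmD _ _) _; apply: le_trans (lerD (Hu _) IH) _.
  by rewrite CK exprD exprS le_eqVlt; apply/orP; left; apply/eqP; ring.
have Hnm N n m : (N <= n)%N -> (N <= m)%N -> nrm (u n - u m) <= 2 * K * q ^+ N.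
  have H k : (N <= k)%N -> nrm (u k - u N) <= K * q ^+ N.
    move=> /subnKC {1}<-; apply: le_trans (Hk _ _) _.
    rewrite mulrBr mulr1 lerBlDr lerDl.
  by rewrite !mulr_ge0 ?exprn_ge0.
  move=> Nn Nm; have -> : u n - u m = (u n - u N) - (u m - u N).
    by rewrite opprB addrA subrK.
  apply: le_trans (nrmB _ _) _; have := H _ Nn; have := H _ Nm; lra.
have small e : 0 < e -> exists N, 2 * K * q ^+ N < e.
  move=> e0; have := @cvg_geometric R (2 * K) q; rewrite ger0_norm // => /(_ q1).
  move=> /cvgrPdist_lt/(_ _ e0)[N _ /(_ N (leqnn N))] /=.
  rewrite sub0r normrN ger0_norm; first by exists N.
  by rewrite !mulr_ge0 ?exprn_ge0.
pose U := (u : nat -> cstar_banach A).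
have cU : cvg (U @ \oo).
  apply/cauchy_cvgP/cauchy_ballP => e e0; near_simpl.
  have ee : e = (complex.Re e)%:C by rewrite RRe_real // gtr0_real.
  have [N HN] := small (complex.Re e) ltac:(by rewrite -ltcR -ee).
  exists ([set n | N <= n], [set n | N <= n])%N; first by split; exists N.
  move=> [n m] [/= Nn Nm]; rewrite -ball_normE /=.
  have := nrmE (u n - u m); rewrite /U => ->.
  by rewrite ee ltcR; apply: le_lt_trans HN; exact: Hnm.
exists (lim (U @ \oo)) => e e0.
have e0' : 0 < e%:C by rewrite ltcR.
have /cvgrPdist_lt/(_ _ e0')[N _ HN] := cU.
exists N => n Nn; have := HN n Nn => /=.
by rewrite distrC -ltcR -nrmE.
Qed.

End RealNorm.

(** * Square roots *)

Lemma le0_eps (R : realType) (a K : R) : (forall e, 0 < e -> a <= K * e) -> a <= 0.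
Proof.
move=> H; rewrite leNgt; apply/negP => a0.
have k0 : 0 < 2 * (`|K| + 1) by have := normr_ge0 K; lra.
have e0 : 0 < a / (2 * (`|K| + 1)) by rewrite divr_gt0.
have := H _ e0; move: e0; set e := a / _ => e0.
have -> : a = e * (2 * (`|K| + 1)) by rewrite /e divfK // gt_eqF.
have := ler_norm K; have := normr_ge0 K; nra.
Qed.

Section SquareRoot.
Context {R : realType} {A : cstarAlgebra R}.
Implicit Types (x y z w : A) (t : R).

Lemma nrm_eps0 x (K : R) : (forall e, 0 < e -> nrm x <= K * e) -> x = 0.
Proof.
by move=> H; apply: nrm0_eq0; apply/eqP; rewrite eq_le nrm_ge0 (le0_eps H).
Qed.

(* The square root is [1 - s] with [s = (v + s^2) / 2], and the map
   [s |-> (v + s^2) / 2] contracts the ball of radius [nrm v]. *)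
Lemma sqrt_one_sub v : star v = v -> nrm v < 1 ->
  exists e : A, [/\ star e = e, e * e = 1 - v &
    forall b : A, b * v = v * b -> b * e = e * b].
Proof.
move=> sv v1; set r := nrm v in v1; have r0 : 0 <= r := nrm_ge0 v.
pose f s : A := (2^-1)%:C *: (v + s * s).
have nf s : nrm (f s) = 2^-1 * nrm (v + s * s) by rewrite nrmZr ger0_norm.
have sub_sq s s' : s * s - s' * s' = s * (s - s') + (s - s') * s'.
  by rewrite mulrBr mulrBl addrA subrK.
have ff s s' : f s - f s' = (2^-1)%:C *: (s * (s - s') + (s - s') * s').
  by rewrite /f -scalerBr opprD addrACA subrr add0r sub_sq.
have nff s s' : nrm (f s - f s') <= 2^-1 * (nrm s + nrm s') * nrm (s - s').
  rewrite ff nrmZr ger0_norm // -mulrA; apply: ler_wpM2l => //.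
  apply: le_trans (nrmD _ _) _; apply: le_trans (lerD (nrmM _ _) (nrmM _ _)) _.
  by rewrite mulrDl [X in _ + X <= _]mulrC.
pose u n := iter n f 0.
have ur n : nrm (u n) <= r.
  elim: n => [|n IH] /=; first by rewrite nrm0.
  rewrite nf; have h1 := nrmD v (u n * u n); have h2 := nrmM (u n) (u n).
  have h3 := nrm_ge0 (u n); rewrite -/r in h1.
  nra.
(* All iterates lie in the ball of radius [r], where the Lipschitz factor in [nff] is at most
   [(r + r) / 2 = r < 1]. *)
have du n : nrm (u n.+1 - u n) <= 1 * r ^+ n.
  rewrite mul1r; elim: n => [|n IH].
    by rewrite /= subr0 nf mulr0 addr0 -/r expr0; lra.
  rewrite /= (le_trans (nff _ _)) // exprS.
  apply: ler_pM => //; rewrite ?nrm_ge0 ?mulr_ge0 ?addr_ge0 ?nrm_ge0 //.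
  have := ur n; have := ur n.+1 => /=; lra.
have [||l ul] := @complete_geometric R A u 1 r; rewrite ?r0 ?v1 //.
have appr e : 0 < e -> exists n, nrm (u n - l) < e /\ nrm (u n.+1 - l) < e.
  move=> /ul[N HN]; exists N; split; exact: HN.
have fl : f l = l.
  apply/subr0_eq; apply: (@nrm_eps0 _ (1 + 2^-1 * (r + nrm l))) => e e0.
  have [n [H1 H2]] := appr e e0.
  have -> : f l - l = (u n.+1 - l) - (f (u n) - f l).
    by rewrite /= opprB [RHS]addrC addrA subrK.
  have h1 := nrmB (u n.+1 - l) (f (u n) - f l); have h2 := nff (u n) l.
  have h3 := nrm_ge0 (u n); have h4 := nrm_ge0 l; have h5 := ur n.
  apply: le_trans h1 _; rewrite mulrDl mul1r; apply: lerD; first exact: ltW.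
  apply: le_trans h2 _; apply: ler_pM; rewrite ?nrm_ge0 ?mulr_ge0 ?addr_ge0 //.
    by rewrite ler_wpM2l // lerD2r.
  exact: ltW.
have su n : star (u n) = u n.
  by elim: n => [|n IH] /=; [rewrite -(subrr 1) starB !subrr
                            | rewrite /f starZr starD starM IH sv].
have sl : star l = l.
  apply/subr0_eq; apply: (@nrm_eps0 _ 2) => e e0; have [n [H1 _]] := appr e e0.
  have -> : star l - l = (u n - l) - star (u n - l).
    by rewrite starB su opprB [RHS]addrC addrA subrK.
  have := nrmB (u n - l) (star (u n - l)); rewrite nrm_star; lra.
exists (1 - l); split.
- by rewrite starB star1 sl.
(* The fixed point equation reads [l^2 = 2 l - v], that is, [(1 - l)^2 = 1 - v]. *)
- have ll : l * l = l + l - v.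
    rewrite -[l in RHS]fl -scalerDl -rmorphD /=.
    have -> : 2^-1 + 2^-1 = 1 :> R by lra.
    by rewrite scale1r addrC addKr.
  by rewrite mulrBl mul1r mulrBr mulr1 ll opprB (addrAC (l + l)) addrK addrA subrK.
- move=> b bv; rewrite mulrBl mulrBr mul1r mulr1; congr (_ - _).
  (* The iterates are polynomials in [v], so [b] commutes with each of them, and then with their
     limit. *)
  have bu n : b * u n = u n * b.
    elim: n => [|n IH] /=; first by rewrite mulr0 mul0r.
    by rewrite /f scAl scAr mulrDr mulrDl bv mulrA IH -mulrA IH mulrA.
  apply/subr0_eq; apply: (@nrm_eps0 _ (2 * nrm b)) => e e0.
  have [n [H1 _]] := appr e e0.
  have -> : b * l - l * b = (u n - l) * b - b * (u n - l).
    by rewrite mulrBl mulrBr bu opprB [RHS]addrC addrA subrK.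
  have := nrmB ((u n - l) * b) (b * (u n - l)).
  have := nrmM (u n - l) b; have := nrmM b (u n - l); have := nrm_ge0 b; nra.
Qed.
End SquareRoot.

(** * The positive cone *)

Section Cone.
Context {R : realType} {A : cstarAlgebra R}.
Implicit Types (x y z w : A) (t : R).

Definition sca t : A := t%:C *: (1 : A).

Lemma scaMl t x : sca t * x = t%:C *: x. Proof. by rewrite /sca scAl mul1r. Qed.
Lemma scaMr t x : x * sca t = t%:C *: x. Proof. by rewrite /sca scAr mulr1. Qed.
Lemma star_sca t : star (sca t) = sca t. Proof. by rewrite /sca starZr star1. Qed.
Lemma scaD s t : sca (s + t) = sca s + sca t.
Proof. by rewrite /sca rmorphD scalerDl. Qed.
Lemma scaB s t : sca (s - t) = sca s - sca t.
Proof. by rewrite /sca rmorphB scalerBl. Qed.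
Lemma scaM s t : sca (s * t) = s%:C *: sca t.
Proof. by rewrite /sca rmorphM scalerA. Qed.
Lemma sca1 : sca 1 = 1. Proof. by rewrite /sca scale1r. Qed.
Lemma nrm_sca t : nrm (sca t) <= `|t|. Proof. exact: nrmZ1. Qed.

(* The spectrum-free form of positivity: in the language of spectra, the ball
   of radius [t] around [t] meets the real line in [0, 2t]. *)
Definition cpos w : Prop :=
  star w = w /\ exists2 t, 0 <= t & nrm (sca t - w) <= t.

Lemma cpos_ge w t s : nrm (sca t - w) <= t -> t <= s -> nrm (sca s - w) <= s.
Proof.
move=> tw ts.
have -> : sca s - w = sca (s - t) + (sca t - w) by rewrite scaB addrA subrK.
have := nrmD (sca (s - t)) (sca t - w); have := nrm_sca (s - t).
by rewrite ger0_norm ?subr_ge0 //; lra.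
Qed.

Lemma cposD w z : cpos w -> cpos z -> cpos (w + z).
Proof.
move=> [sw [t t0 wt]] [sz [s s0 zs]]; split; first by rewrite starD sw sz.
exists (t + s); first exact: addr_ge0.
by rewrite scaD opprD addrACA (le_trans (nrmD _ _)) // lerD.
Qed.

Lemma cposZ (c : R) w : 0 <= c -> cpos w -> cpos (c%:C *: w).
Proof.
move=> c0 [sw [t t0 wt]]; split; first by rewrite starZr sw.
exists (c * t); first exact: mulr_ge0.
by rewrite scaM -scalerBr nrmZr ger0_norm // ler_wpM2l.
Qed.

Lemma cpos_sca t : 0 <= t -> cpos (sca t).
Proof.
by move=> t0; split; [exact: star_sca | exists t => //; rewrite subrr nrm0].
Qed.

Lemma cpos_nrm w t : star w = w -> nrm w <= t -> cpos (sca t - w).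
Proof.
move=> sw wt; split; first by rewrite starB star_sca sw.
exists t; first exact: le_trans (nrm_ge0 _) wt.
by rewrite opprB addrC subrK.
Qed.

(** With [T = t + d] one has [w + d = T (1 - v)], where [nrm v <= t / T < 1]. The shift by [d] makes
    this bound strict, so that [sqrt_one_sub] applies to [v]. *)
Lemma cpos_sqrt w d : cpos w -> 0 < d -> exists e : A,
  [/\ star e = e, e * e = w + sca d & forall b, b * w = w * b -> b * e = e * b].
Proof.
move=> [sw [t t0 wt]] d0; set T := t + d; have T0 : 0 < T by rewrite /T; lra.
pose v := (T^-1)%:C *: (sca t - w).
have sv : star v = v by rewrite /v starZr starB star_sca sw.
have nv : nrm v < 1.
  rewrite /v nrmZr gtr0_norm ?invr_gt0 // -ltr_pdivlMl ?invr_gt0 // invrK mulr1.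
  by apply: le_lt_trans wt _; rewrite /T; lra.
have [e [se ee be]] := sqrt_one_sub sv nv.
have TT : Num.sqrt T * Num.sqrt T = T by rewrite -expr2 sqr_sqrtr // ltW.
exists ((Num.sqrt T)%:C *: e); split.
- by rewrite starZr se.
- rewrite scAl scAr scalerA -rmorphM /= TT ee scalerBr scalerA -rmorphM /= mulfV ?gt_eqF //.
  by rewrite scale1r -/(sca T) /T scaD opprB addrC addrA subrK.
- move=> b bw; rewrite scAl scAr be // /v scAl scAr mulrBr mulrBl bw.
  by rewrite scaMl scaMr.
Qed.

(* With [u = h + i k] one has [u^* u = t] and [2 h = u + u^*]. *)
Lemma sum_sqr_bound h k t : star h = h -> star k = k -> h * k = k * h ->
  h * h + k * k = sca t -> nrm h ^+ 2 <= `|t|.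
Proof.
move=> sh sk hk ht; pose u := h + 'i%C *: k.
have su : star u = h - 'i%C *: k.
  rewrite /u starD sh starZ sk conjE -scaleNr; congr (_ + _ *: _).
  by apply/eqP; rewrite eq_complex /= oppr0 !eqxx.
have uu : star u * u = sca t.
  rewrite su /u mulrDr !mulrBl scAl scAr scAl scAr hk -ht.
  have ii : 'i%C * 'i%C = -1 :> R[i] by exact: sqr_i.
  by rewrite addrA subrK scalerA ii scaleN1r opprK.
have nu : nrm u ^+ 2 <= `|t| by rewrite -nrm_starM uu nrm_sca.
have hu : nrm h <= nrm u.
  have -> : h = (2^-1)%:C *: (u + star u).
    rewrite su /u addrACA subrr addr0 scalerDr -scalerDl -rmorphD /=.
    by have -> : 2^-1 + 2^-1 = 1 :> R by [lra]; rewrite scale1r.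
  rewrite nrmZr ger0_norm //; have := nrmD u (star u); rewrite nrm_star; lra.
by apply: le_trans nu; rewrite ler_sqr ?nnegrE ?nrm_ge0.
Qed.

(** For [t = nrm h ^+ 2 + 1] the element [t - h^2] has a self-adjoint root [k] commuting with [h].
    Then [h^2 + k^2 = t], and [sum_sqr_bound] with [h] and [k] exchanged bounds the norm of
    [t - h^2 = k^2] by [t]. *)
Lemma cpos_sqr h : star h = h -> cpos (h * h).
Proof.
move=> sh; set t := nrm h ^+ 2 + 1.
have n0 : 0 <= nrm h ^+ 2 := sqr_ge0 _.
have t0 : 0 < t by rewrite /t; lra.
have shh : star (h * h) = h * h by rewrite starM sh.
have [k [sk kk ck]] : exists k : A,
    [/\ star k = k, k * k = sca t - h * h & h * k = k * h].
  have [||k [sk kk ck]] := @cpos_sqrt (sca (nrm h ^+ 2) - h * h) 1.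
  - by apply: cpos_nrm => //; rewrite nrm_sa_sqr.
  - by [].
  exists k; split=> //; first by rewrite kk addrAC -scaD.
  by apply: ck; rewrite mulrBr mulrBl scaMl scaMr mulrA.
split=> //; exists t; first exact: ltW.
rewrite -kk nrm_sa_sqr // -[leRHS]gtr0_norm //.
by apply: (@sum_sqr_bound _ h) => //; rewrite kk subrK.
Qed.

Lemma cpos_sca_ge0 t : nrm (1 : A) = 1 -> cpos (sca t) -> 0 <= t.
Proof.
move=> n1 [_ [s s0]]; rewrite -scaB nrmZr n1 mulr1.
by have := ler_norm (s - t); lra.
Qed.

(** A root [k] of [t - h^2 + d] commutes with [h], so [sum_sqr_bound] gives [nrm h ^+ 2 <= t + d]
    for every [d > 0]. This bounds the gauge of [h^2] from below later on. *)
Lemma sqr_le_nrm h t : nrm (1 : A) = 1 -> star h = h ->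
  cpos (sca t - h * h) -> nrm h ^+ 2 <= t.
Proof.
move=> n1 sh ht.
have t0 : 0 <= t.
  by apply: cpos_sca_ge0 => //; have := cposD ht (cpos_sqr sh); rewrite subrK.
rewrite -subr_le0; apply: (@le0_eps _ _ 1) => d d0.
have [k [sk kk ck]] := cpos_sqrt ht d0.
have := @sum_sqr_bound h k (t + d) sh sk _ _; rewrite ger0_norm; last lra.
move=> H; suff : nrm h ^+ 2 <= t + d by lra.
apply: H; last by rewrite kk addrA [h * h + _]addrC subrK scaD.
by apply: ck; rewrite mulrBr mulrBl scaMl scaMr mulrA.
Qed.

End Cone.

(** * Kaplansky's theorem *)

Lemma bernoulli_le (R : realType) (a : R) n : 0 <= a -> 1 + n%:R * a <= (1 + a) ^+ n.
Proof.
move=> a0; elim: n => [|n IH]; first by rewrite mul0r addr0 expr0.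
rewrite exprS -natr1.
have : (1 + a) * (1 + n%:R * a) <= (1 + a) * (1 + a) ^+ n.
  by apply: ler_wpM2l => //; lra.
apply: le_trans; have : 0 <= n%:R :> R by []; nra.
Qed.

(** If [a = b (1 + c)] with [c > 0], then [(1 + c)^n] grows at most linearly along [n = 2 ^ k].
    Squaring Bernoulli's inequality at [n] and comparing with the bound at [2 n] gives
    [n c^2 <= 2 K] for all these [n], which is absurd. *)
Lemma le_of_pow2 (R : realType) (a b K : R) : 0 < b -> 0 <= K ->
  (forall k, a ^+ (2 ^ k) <= (1 + (2 ^ k)%:R * K) * b ^+ (2 ^ k)) -> a <= b.
Proof.
move=> b0 K0 H; rewrite leNgt; apply/negP => ab.
have [c c0 ac] : exists2 c, 0 < c & a = b * (1 + c).
  exists (a / b - 1); first by rewrite subr_gt0 ltr_pdivlMr // mul1r.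
  by rewrite addrC subrK mulrC divfK // gt_eqF.
have {}H k : (1 + c) ^+ (2 ^ k) <= 1 + (2 ^ k)%:R * K.
  by have := H k; rewrite ac exprMn [leRHS]mulrC ler_pM2l // exprn_gt0.
have {}H k : (2 ^ k)%:R * c ^+ 2 <= 2 * K.
  have := H k.+1; rewrite expnS mulnC exprM natrM.
  set n := (2 ^ k)%:R; have n0 : 0 < n by rewrite ltr0n expn_gt0.
  have := @bernoulli_le _ c (2 ^ k) (ltW c0); rewrite -/n.
  set X := (1 + c) ^+ _ => XX.
  have nc : 0 < n * c by rewrite mulr_gt0.
  have XX2 : (1 + n * c) ^+ 2 <= X ^+ 2.
    by rewrite ler_sqr ?nnegrE //; lra.
  move=> /(le_trans XX2) XK.
  rewrite -(ler_pM2l n0); move: XK; rewrite !expr2; nra.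
have [k Hk] : exists k : nat, 2 * K / c ^+ 2 < k%:R.
  exists (Num.bound (2 * K / c ^+ 2)); apply: archi_boundP.
  by rewrite divr_ge0 ?mulr_ge0 ?exprn_ge0 // ltW.
have := H k; apply/negP; rewrite -ltNge -ltr_pdivrMr ?exprn_gt0 //.
by apply: lt_le_trans Hk _; rewrite ler_nat ltnW // ltn_expl.
Qed.

Section Kaplansky.
Context {R : realType} {A : cstarAlgebra R}.
Implicit Types (x y z w : A) (t : R).

Lemma nrmX x n : nrm (x ^+ n) <= nrm x ^+ n.
Proof.
elim: n => [|n IH]; first by rewrite !expr0 nrm1_le1.
by rewrite !exprS (le_trans (nrmM _ _)) // ler_wpM2l // nrm_ge0.
Qed.

(** Iterating the C*-identity for squares reaches exactly the exponents that are powers of two. *)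
Lemma nrm_sa_pow2 x k : star x = x -> nrm (x ^+ (2 ^ k)) = nrm x ^+ (2 ^ k).
Proof.
move=> sx; elim: k => [|k IH] //.
have sX n : star (x ^+ n) = x ^+ n.
  by elim: n => [|n IHn]; rewrite ?expr0 ?star1 // exprS starM IHn sx -exprSr exprS.
by rewrite expnS mulnC !exprM expr2 nrm_sa_sqr // IH.
Qed.

(* Write z' for the adjoint.  Since (T - z'z)^n z' = z'(T - zz')^n, the norm
   of (T - z'z)^n is at most 1 + O(n) times the n-th power of a bound of
   T - zz'; taking n = 2^k and n-th roots removes this factor. *)
Lemma cpos_swap z t : 0 <= t -> cpos (z * star z + sca t) ->
  cpos (star z * z + sca t).
Proof.
move=> t0 [_ [T' T'0 HT']].
split; first by rewrite starD starM starK star_sca.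
set b := T' + t + 1; have b0 : 0 < b by rewrite /b; lra.
exists b; first exact: ltW.
have {}HT' : nrm (sca b - (z * star z + sca t)) <= b.
  by apply: cpos_ge HT' _; rewrite /b; lra.
pose T := b - t; have T0 : 0 <= T by rewrite /T /b; lra.
have E w : sca b - (w + sca t) = sca T - w by rewrite /T scaB opprD addrA addrAC.
rewrite !E in HT' *; set s := sca T - _ in HT'; set d := sca T - _.
have dz : d * star z = star z * s by rewrite mulrBl mulrBr scaMl scaMr mulrA.
have dnz n : d ^+ n * star z = star z * s ^+ n.
  elim: n => [|n IH]; first by rewrite !expr0 mul1r mulr1.
  by rewrite exprS -mulrA IH mulrA dz -mulrA -exprS.
have sd : star d = d by rewrite starB star_sca starM starK.
have sn n : nrm (s ^+ n) <= b ^+ n.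
  by apply: le_trans (nrmX _ _) _; rewrite lerXn2r ?nnegrE ?nrm_ge0 // ltW.
have [K K0 zK] : exists2 K, 0 <= K & nrm z ^+ 2 = K * b.
  by exists (nrm z ^+ 2 / b); rewrite ?divr_ge0 ?sqr_ge0 ?divfK ?gt_eqF // ltW.
(* Induction on [d^(n+1) = T d^n - z' s^n z]: the first term is at most [b (1 + n K) b^n], and the
   second adds [nrm z ^+ 2 * b^n = K b b^n]. *)
have dn n : nrm (d ^+ n) <= (1 + n%:R * K) * b ^+ n.
  elim: n => [|n IH]; first by rewrite !expr0 mul0r addr0 mulr1 nrm1_le1.
  have -> : d ^+ n.+1 = T%:C *: d ^+ n - star z * s ^+ n * z.
    by rewrite exprSr {2}/d mulrBr scaMr mulrA dnz.
  have h1 := nrmB (T%:C *: d ^+ n) (star z * s ^+ n * z).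
  rewrite nrmZr ger0_norm // in h1; apply: le_trans h1 _.
  have h2 : nrm (star z * s ^+ n * z) <= K * b * b ^+ n.
    apply: le_trans (nrmM _ _) _; rewrite -zK expr2 mulrAC.
    apply: ler_wpM2r; first exact: nrm_ge0.
    apply: le_trans (nrmM _ _) _; rewrite nrm_star.
    by apply: ler_wpM2l => //; exact: nrm_ge0.
  have h3 : T * nrm (d ^+ n) <= b * ((1 + n%:R * K) * b ^+ n).
    by apply: ler_pM => //; [exact: nrm_ge0 | rewrite /T; lra].
  apply: le_trans (lerD h3 h2) _; rewrite -natr1 exprS.
  by rewrite le_eqVlt; apply/orP; left; apply/eqP; ring.
apply: (@le_of_pow2 _ _ _ K) => // k.
by rewrite -nrm_sa_pow2.
Qed.

(** Up to scalars [a] and [b] are the real and imaginary parts of [y], and the element is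
    [(a^2 + b^2) / 2]. *)
Lemma cpos_starD y : cpos (y * star y + star y * y).
Proof.
pose a := y + star y; pose b := 'i%C *: (y - star y).
have sa : star a = a by rewrite starD starK addrC.
have ii : 'i%C * 'i%C = -1 :> R[i] by exact: sqr_i.
have sb : star b = b.
  rewrite /b starZ conjE starB starK -opprB scalerN -scaleNr; congr (_ *: _).
  by apply/eqP; rewrite eq_complex /= oppr0 opprK !eqxx.
have -> : y * star y + star y * y = (2^-1)%:C *: (a * a + b * b).
  have -> : b * b = - ((y - star y) * (y - star y)).
    by rewrite /b scAl scAr scalerA ii scaleN1r.
  have -> : a * a - (y - star y) * (y - star y)
          = (1 + 1)%:C *: (y * star y + star y * y).
    rewrite rmorphD /= scalerDl !scale1r /a; set q := star y.
    have -> : (y + q) * (y + q) = (y * y + q * q) + (y * q + q * y).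
      by rewrite mulrDl !mulrDr [q * y + _]addrC addrACA.
    have -> : (y - q) * (y - q) = (y * y + q * q) - (y * q + q * y).
      by rewrite mulrBl !mulrBr opprB addrACA -opprD.
    by rewrite opprB addrC addrA subrK.
  rewrite scalerA -rmorphM /=.
  by have -> : 2^-1 * (1 + 1) = 1 :> R by [lra]; rewrite scale1r.
by apply: cposZ => //; apply: cposD; exact: cpos_sqr.
Qed.

(* If [x = y'y <= M], put [z = y e] with [e^2 = 2 M - x]; then
   [z'z = x (2 M - x) <= M^2], and [2 M x = z'z + x^2], so that any bound
   [z'z >= - k M^2] improves to [x >= - (k / 2) M]. *)
Lemma kaplansky_iter j y M : 0 < M -> cpos (sca M - star y * y) ->
  cpos (star y * y + sca (M / 2 ^+ j)).
Proof.
elim: j y M => [|j IH] y M M0 yM.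
  (* Base case: adding [y y' + y' y >= 0] and [M - y' y >= 0] gives [y y' + M >= 0], and [cpos_swap]
     exchanges the factors. *)
  rewrite expr0 divr1; apply: cpos_swap; first exact: ltW.
  by have := cposD (cpos_starD y) yM; rewrite addrA addrAC addrK.
have [e [se ee ce]] := cpos_sqrt yM M0.
set x := star y * y in yM ee ce *.
have xe : x * e = e * x by apply: ce; rewrite mulrBr mulrBl scaMl scaMr.
have sx : star x = x by rewrite starM starK.
have zz : star (y * e) * (y * e) = (2 * M)%:C *: x - x * x.
  rewrite starM se mulrA -(mulrA e) -/x -xe -mulrA ee addrAC -scaD mulrBr scaMr.
  by rewrite mulr_natl.
(* The difference [M^2 - z'z] is the square [(x - M)^2]; so the induction hypothesis applies to [z]
   with bound [M^2]. *)
have zM : cpos (sca (M ^+ 2) - star (y * e) * (y * e)).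
  have : cpos ((x - sca M) * (x - sca M)).
    by apply: cpos_sqr; rewrite starB sx star_sca.
  rewrite zz mulrBl !mulrBr !scaMl scaMr expr2 scaM.
  have -> : (2 * M)%:C *: x = M%:C *: x + M%:C *: x.
    by rewrite -scalerDl -rmorphD /=; congr (_%:C *: _); lra.
  by rewrite !opprB addrACA -opprD [_ + _%:C *: sca M]addrC -addrA.
have := IH _ _ (exprn_gt0 2 M0) zM; rewrite zz => H.
have := cposZ _ (cposD H (cpos_sqr sx)).
move=> /(_ (2 * M)^-1); rewrite invr_ge0 mulr_ge0 ?(ltW M0) // => /(_ isT).
rewrite addrAC subrK scalerDr scalerA -rmorphM /= mulVf ?gt_eqF ?mulr_gt0 //.
rewrite scale1r -scaM; congr (cpos (_ + sca _)).
by rewrite [2 ^+ j.+1]exprS; field; rewrite expf_neq0 ?gt_eqF.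
Qed.

Theorem cpos_starM y (d : R) : 0 < d -> cpos (star y * y + sca d).
Proof.
move=> d0; set M := nrm y ^+ 2 + 1.
have M0 : 0 < M by rewrite /M; have := sqr_ge0 (nrm y); lra.
have yM : cpos (sca M - star y * y).
  by apply: cpos_nrm; rewrite ?starM ?starK // nrm_starM /M; lra.
have [k Hk] : exists k : nat, M / d < k%:R.
  by exists (Num.bound (M / d)); apply: archi_boundP; rewrite divr_ge0 // ltW.
have Mk : M / 2 ^+ k <= d.
  rewrite ler_pdivrMr ?exprn_gt0 // mulrC -ler_pdivrMr // (le_trans (ltW Hk)) //.
  by rewrite -natrX ler_nat ltnW // ltn_expl.
have -> : sca d = sca (M / 2 ^+ k) + sca (d - M / 2 ^+ k) :> A.
  by rewrite -scaD addrC subrK.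
rewrite addrA; apply: cposD; first exact: kaplansky_iter.
by apply: cpos_sca; rewrite subr_ge0.
Qed.

End Kaplansky.

(** * Sublinear functionals *)

Section HahnBanach.
Context {R : realType} {V : lmodType R[i]}.
Implicit Types (p q : V -> R) (x y v : V) (L : set (V * R)).

Record real_sublinear p : Prop := RealSublinear {
  sublinD : forall x y, p (x + y) <= p x + p y;
  sublinZ : forall t x, 0 < t -> p (t%:C *: x) = t * p x
}.

Lemma scaleCVK (t : R) x : 0 < t -> (t^-1)%:C *: (t%:C *: x) = x.
Proof. by move=> t0; rewrite scalerA -rmorphM /= mulVf ?gt_eqF // scale1r. Qed.

Lemma sublin_le p : (forall x y, p (x + y) <= p x + p y) ->
  (forall t x, 0 < t -> p (t%:C *: x) <= t * p x) -> real_sublinear p.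
Proof.
move=> pD pZ; split=> // t x t0; apply/eqP; rewrite eq_le pZ //=.
have t0' : 0 < t^-1 by rewrite invr_gt0.
by rewrite -ler_pdivlMl // -{1}(scaleCVK x t0) pZ.
Qed.

Lemma sublin0 p : real_sublinear p -> p 0 = 0.
Proof.
by move=> /sublinZ/(_ 2 0 ltac:(by []))/eqP; rewrite scaler0 => /eqP; lra.
Qed.

Lemma sublinN p x : real_sublinear p -> - p (- x) <= p x.
Proof. by move=> sp; have := sublinD sp x (- x); rewrite subrr sublin0 //; lra. Qed.

(** A pair [(v, c)] in the convex cone [L] stands for the constraint [q v <= c]. The infimum of
    [p (x - v) + c] over [L] meets all of them; the last hypothesis on [L] keeps it above
    [- p (- x)]. *)
Lemma sublin_cone p L : real_sublinear p -> L (0, 0) ->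
  (forall v c w d, L (v, c) -> L (w, d) -> L (v + w, c + d)) ->
  (forall t v c, 0 < t -> L (v, c) -> L (t%:C *: v, t * c)) ->
  (forall v c, L (v, c) -> - p (- v) <= c) ->
  exists q, [/\ real_sublinear q, forall x, q x <= p x &
    forall v c, L (v, c) -> q v <= c].
Proof.
move=> sp L0 LD LZ Lp.
pose S x := [set p (x - vc.1) + vc.2 | vc in L].
have lbS x : lbound (S x) (- p (- x)).
  move=> _ [[v c] /= Lv <-]; have := Lp _ _ Lv.
  have := sublinD sp (x - v) (- x); rewrite addrAC subrr add0r; lra.
have SL x : has_lbound (S x) by exists (- p (- x)).
have S0 x : S x !=set0 by exists (p (x - 0) + 0); exists (0, 0).
pose q x := inf (S x).
have qle x v c : L (v, c) -> q x <= p (x - v) + c.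
  by move=> Lv; apply: ge_inf => //; exists (v, c).
exists q; split; last 2 first.
- by move=> x; have := qle x _ _ L0; rewrite subr0 addr0.
- by move=> v c /(qle v); rewrite subrr sublin0 // add0r.
apply: sublin_le => [x y|t x t0].
  rewrite -lerBlDr; apply: lb_le_inf => // _ [[v c] /= Lv <-].
  rewrite lerBlDl -lerBlDr; apply: lb_le_inf => // _ [[w d] /= Lw <-].
  have := qle (x + y) _ _ (LD _ _ _ _ Lv Lw); rewrite opprD addrACA /=.
  by have := sublinD sp (x - v) (y - w); lra.
rewrite -ler_pdivrMl //; apply: lb_le_inf => // _ [[v c] /= Lv <-].
rewrite ler_pdivrMl // mulrDr -sublinZ // scalerBr.
by apply: qle; exact: LZ.
Qed.

(** Zorn's lemma for the reversed pointwise order: the pointwise infimum of a nonempty chain is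
    finite, each member being at least [- p (- x)], and it is sublinear. *)
Lemma sublin_minimal p : real_sublinear p -> exists q, [/\ real_sublinear q,
  forall x, q x <= p x &
  forall q', real_sublinear q' -> (forall x, q' x <= q x) -> q' = q].
Proof.
move=> sp; pose T := {q | real_sublinear q /\ forall x, q x <= p x}.
pose le (f g : T) := `[< forall x, sval g x <= sval f x >].
have [||||[q [sq qp]] qmin] := @Zorn T le.
- by move=> f; exact/asboolP.
- move=> f g h /asboolP fg /asboolP gh; apply/asboolP => x.
  exact: le_trans (gh x) (fg x).
- move=> [f ?] [g ?] /asboolP /= fg /asboolP /= gf; apply: eq_exist.
  by apply/funext => x; apply/eqP; rewrite eq_le fg gf.
- move=> F tF; have [[f0 Ff0]|F0] := pselect (F !=set0); last first.
    have pp : real_sublinear p /\ forall x, p x <= p x by [].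
    by exists (exist _ p pp) => f Ff; case: F0; exists f.
  pose S x := [set sval f x | f in F].
  have lbS x : lbound (S x) (- p (- x)).
    move=> _ [[f [sf fp]] Ff <-] /=; apply: le_trans (sublinN x sf).
    by rewrite lerN2.
  have SL x : has_lbound (S x) by exists (- p (- x)).
  have S0 x : S x !=set0 by exists (sval f0 x); exists f0.
  pose q x := inf (S x).
  have qle x f : F f -> q x <= sval f x by move=> Ff; apply: ge_inf => //; exists f.
  have sq : real_sublinear q.
    apply: sublin_le => [x y|t x t0].
      rewrite -lerBlDr; apply: lb_le_inf => // _ [f Ff <-].
      rewrite lerBlDl -lerBlDr; apply: lb_le_inf => // _ [g Fg <-].
      (* Of two members of the chain, the smaller one serves for both [x] and [y]. *)
      have [/asboolP fg|/asboolP gf] := tF _ _ Ff Fg.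
        have := qle (x + y) _ Fg; have [sg _] := svalP g.
        by have := sublinD sg x y; have := fg x; lra.
      have := qle (x + y) _ Ff; have [sf _] := svalP f.
      by have := sublinD sf x y; have := gf y; lra.
    rewrite -ler_pdivrMl //; apply: lb_le_inf => // _ [f Ff <-].
    by have [sf _] := svalP f; rewrite ler_pdivrMl // -(sublinZ sf) // qle.
  have qp x : q x <= p x.
    by have [_ f0p] := svalP f0; apply: le_trans (f0p x); exact: qle.
  exists (exist _ q (conj sq qp)) => f Ff; apply/asboolP => x /=; exact: qle.
exists q; split=> // q' sq' q'q.
have q'p x : q' x <= p x := le_trans (q'q x) (qp x).
have /qmin [] // : le (exist _ q (conj sq qp)) (exist _ q' (conj sq' q'p)).
exact/asboolP.
Qed.

(* A minimal sublinear functional [q] is linear: lowering [q] along the ray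
   [-v] leaves it unchanged, so that [q (- v) <= - q v]. *)
Lemma sublin_dominates p : real_sublinear p -> exists q,
  [/\ forall x y, q (x + y) = q x + q y, forall t x, q (t%:C *: x) = t * q x &
    forall x, q x <= p x].
Proof.
move=> /sublin_minimal[q [sq qp qmin]].
have qN v : q (- v) = - q v.
  pose L := [set vc : V * R | exists2 t, 0 <= t & vc = (t%:C *: - v, - (t * q v))].
  have [||||q' [sq' q'q q'L]] := @sublin_cone q L sq.
  - by exists 0; rewrite // scale0r mul0r oppr0.
  - move=> _ _ _ _ [t t0 [-> ->]] [s s0 [-> ->]]; exists (t + s); first exact: addr_ge0.
    by rewrite rmorphD scalerDl mulrDl opprD.
  - move=> t _ _ t0 [s s0 [-> ->]]; exists (t * s); first by rewrite mulr_ge0 // ltW.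
    by rewrite rmorphM scalerA mulrN mulrA.
  - move=> _ _ [t + [-> ->]]; rewrite le_eqVlt => /orP[/eqP<-|t0].
      by rewrite scale0r oppr0 sublin0 // mul0r.
    by rewrite scalerN opprK sublinZ.
  have /q'L : L (- v, - q v) by exists 1; rewrite // scale1r mul1r.
  rewrite (qmin _ sq' q'q) => qv; apply/eqP; rewrite eq_le qv /=.
  by have := sublinN v sq; lra.
exists q; split=> // [x y|t x].
  apply/eqP; rewrite eq_le sublinD //=.
  by have := sublinD sq (- x) (- y); rewrite -opprD !qN; lra.
have [t0|t0|->] := ltgtP t 0; last by rewrite scale0r mul0r sublin0.
  rewrite -[t]opprK rmorphN scaleNr qN sublinZ ?mulNr //; lra.
exact: sublinZ.
Qed.

(** A real-linear [q] dominated by [p] and meeting the constraints of [L] is the real part of the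
    complex-linear functional [q x - i q (i x)]. *)
Theorem hahn_banach_cone p L : real_sublinear p -> L (0, 0) ->
  (forall v c w d, L (v, c) -> L (w, d) -> L (v + w, c + d)) ->
  (forall t v c, 0 < t -> L (v, c) -> L (t%:C *: v, t * c)) ->
  (forall v c, L (v, c) -> - p (- v) <= c) ->
  exists f : V -> R[i], [/\ forall c x y, f (c *: x + y) = c * f x + f y,
    forall x, complex.Re (f x) <= p x &
    forall v c, L (v, c) -> complex.Re (f v) <= c].
Proof.
move=> sp L0 LD LZ Lp.
have [p' [sp' p'p p'L]] := sublin_cone sp L0 LD LZ Lp.
have [q [qD qZ qp']] := sublin_dominates sp'.
exists (fun x => q x +i* (- q ('i%C *: x))); split=> /=.
- move=> [a b] x y; have ab : a +i* b = a%:C + b%:C * 'i%C.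
    by apply/eqP; rewrite eq_complex /= !(mulr0, mul0r, mulr1, subr0, addr0, add0r) !eqxx.
  have ii : 'i%C * 'i%C = -1 :> R[i] by exact: sqr_i.
  have qN v : q (- v) = - q v by rewrite -scaleN1r -(rmorphN1 (real_complex R)) qZ mulN1r.
  have -> : q ((a +i* b) *: x + y) = a * q x + b * q ('i%C *: x) + q y.
    by rewrite qD ab scalerDl qD -scalerA !qZ.
  have -> : q ('i%C *: ((a +i* b) *: x + y))
          = a * q ('i%C *: x) - b * q x + q ('i%C *: y).
    rewrite scalerDr qD scalerA mulrC -scalerA ab scalerDl qD -scalerA !qZ.
    by rewrite scalerA ii scaleN1r qN mulrN.
  by apply/eqP; rewrite eq_complex /=; apply/andP; split; apply/eqP; ring.
- by move=> x; exact: le_trans (qp' x) (p'p x).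
- by move=> v c /p'L; apply: le_trans.
Qed.

End HahnBanach.

(** * States *)

Section States.
Context {R : realType} {A : cstarAlgebra R}.
Implicit Types (x y z w u h : A) (t : R) (B : set A) (phi psi : A -> R[i]).

Lemma subalgebra_setT : cstar_subalgebra (setT : set A).
Proof. by split=> // ; exact: closedT. Qed.

Lemma cstar_subB B x y : cstar_subalgebra B -> B x -> B y -> B (x - y).
Proof.
by move=> hB Bx By; rewrite -scaleN1r; apply: cstar_subD => //; exact: cstar_subZ.
Qed.

Lemma cstar_sub_sca B t : cstar_subalgebra B -> B (sca t).
Proof. by move=> hB; apply: cstar_subZ => //; exact: cstar_sub1. Qed.

Lemma normcE_real (t : R) : Normc.normc (t%:C) = `|t|.
Proof. by rewrite /= expr0n addr0 sqrtr_sqr. Qed.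

Lemma normc_nneg (c : R[i]) : 0 <= Normc.normc c.
Proof. by case: c => a b; exact: sqrtr_ge0. Qed.

Section OneState.
Context {B : set A} {phi : A -> R[i]}.
Hypotheses (hB : cstar_subalgebra B) (sphi : state_on B phi).

Lemma stateD x y : B x -> B y -> phi (x + y) = phi x + phi y.
Proof. by move=> Bx By; have := state_linear sphi 1 Bx By; rewrite scale1r mul1r. Qed.

Lemma state0 : phi 0 = 0.
Proof.
have B0 : B 0 by rewrite -(scale0r (1 : A)); apply: cstar_subZ (cstar_sub1 hB).
by have /eqP := stateD B0 B0; rewrite addr0 -subr_eq0 opprD addrA subrr sub0r oppr_eq0 => /eqP.
Qed.

Lemma stateZ (c : R[i]) x : B x -> phi (c *: x) = c * phi x.
Proof.
move=> Bx; have B0 : B 0 by rewrite -(scale0r x); exact: cstar_subZ.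
by have := state_linear sphi c Bx B0; rewrite !addr0 state0 addr0.
Qed.

Lemma stateB x y : B x -> B y -> phi (x - y) = phi x - phi y.
Proof.
by move=> Bx By; rewrite -scaleN1r stateD ?stateZ ?mulN1r //; exact: cstar_subZ.
Qed.

Lemma state_sqr_ge0 x : B x -> 0 <= phi (star x * x).
Proof. by move=> Bx; apply: (state_ge0 sphi); exists x. Qed.

Lemma state_le1 x : B x -> nrm x <= 1 -> Normc.normc (phi x) <= 1.
Proof.
move=> Bx x1; have [ub _] := state_norm1 sphi; rewrite -lecR.
by apply: ub; exists x => //; split=> //; rewrite nrmE lecR.
Qed.

Lemma state_le_nrm x : B x -> Normc.normc (phi x) <= nrm x.
Proof.
move=> Bx; have [/nrm0_eq0->|x0] := eqVneq (nrm x) 0.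
  by rewrite state0 nrm0 Normc.normc0.
have {}x0 : 0 < nrm x by rewrite lt0r x0 nrm_ge0.
have := @state_le1 ((nrm x)^-1%:C *: x) (cstar_subZ hB _ Bx).
rewrite nrmZr stateZ // Normc.normcM normcE_real gtr0_norm ?invr_gt0 //.
by rewrite mulVf ?gt_eqF // ler_pdivrMl // mulr1; apply.
Qed.

Lemma state_expand u y (c : R[i]) : B u -> B y ->
  phi (star (u + c *: y) * (u + c *: y)) =
  phi (star u * u) + c * phi (star u * y) + c^*%C * phi (star y * u)
  + c * c^*%C * phi (star y * y).
Proof.
move=> Bu By.
have Bs := @cstar_sub_star _ _ _ hB; have Bm := @cstar_subM _ _ _ hB.
have BZ := @cstar_subZ _ _ _ hB; have BD := @cstar_subD _ _ _ hB.
have -> : star (u + c *: y) * (u + c *: y) = star u * u + c *: (star u * y)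
    + c^*%C *: (star y * u) + (c * c^*%C) *: (star y * y).
  rewrite starD starZ conjE mulrDl !mulrDr !scAl !scAr scalerA.
  by rewrite addrA [c^*%C * c]mulrC.
by rewrite !stateD ?stateZ; auto 8.
Qed.

(** By [state_expand], the number [c phi (u'y) + conj c phi (y'u)] is real for every scalar [c]; the
    cases [c = 1] and [c = i] give the claim. *)
Lemma state_herm u y : B u -> B y -> phi (star y * u) = (phi (star u * y))^*%C.
Proof.
move=> Bu By.
have E c : complex.Im (c * phi (star u * y) + c^*%C * phi (star y * u)) = 0.
  have Bc : B (u + c *: y) by apply: cstar_subD => //; exact: cstar_subZ.
  have := state_sqr_ge0 Bc; rewrite state_expand //.
  have := state_sqr_ge0 Bu; have := state_sqr_ge0 By.
  case: (phi (star u * u)) (phi (star y * y)) => [a a'] [b b'].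
  rewrite !lecE /= => /andP[/eqP-> _] /andP[/eqP-> _] /andP[/eqP + _].
  case: c {Bc} (phi (star u * y)) (phi (star y * u)) => [c c'] [m m'] [n n'] /=.
  by move=> H; rewrite -H; ring.
have := E 1; have := E 'i%C.
case: (phi (star u * y)) (phi (star y * u)) => [m m'] [n n'] /= H1 H2.
by apply/eqP; rewrite eq_complex /=; apply/andP; split; apply/eqP; lra.
Qed.

Lemma cauchy_schwarz u y : B u -> B y -> Normc.normc (phi (star u * y)) ^+ 2 <=
  complex.Re (phi (star u * u)) * complex.Re (phi (star y * y)).
Proof.
move=> Bu By.
have := state_sqr_ge0 Bu; have := state_sqr_ge0 By.
have E c : 0 <= phi (star u * u) + c * phi (star u * y)
    + c^*%C * (phi (star u * y))^*%C + c * c^*%C * phi (star y * y).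
  rewrite -(state_herm Bu By) -state_expand //.
  by apply: state_sqr_ge0; apply: cstar_subD => //; exact: cstar_subZ.
move: E; case: (phi (star u * u)) (phi (star y * y)) (phi (star u * y)) => [a a'] [b b'] [m m'] E.
rewrite !lecE /= => /andP[/eqP b'0 b0] /andP[/eqP a'0 a0].
rewrite sqr_sqrtr ?addr_ge0 ?sqr_ge0 //; subst a' b'.
set k := m ^+ 2 + m' ^+ 2; have k0 : 0 <= k by rewrite addr_ge0 ?sqr_ge0.
(* The scalar is [c = - s] times the conjugate of [phi (u'y)]. Below, [s = 1 / b] is optimal when
   [b > 0]; when [b = 0], the value [s = (a + 1) / (2 k)] makes the expression equal to [-1]. *)
have {}E s : 0 <= a - 2 * s * k + s ^+ 2 * k * b.
  have := E (- s * m +i* (s * m')); rewrite lecE /= => /andP[_].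
  by congr (_ <= _); rewrite /k; ring.
have [b00|bn0] := eqVneq b 0.
  move: E; rewrite b00 mulr0 => E; rewrite leNgt; apply/negP => kp.
  have := E ((a + 1) / (2 * k)).
  have -> : 2 * ((a + 1) / (2 * k)) * k = a + 1 by field; rewrite gt_eqF.
  lra.
have bp : 0 < b by rewrite lt0r bn0.
have := E b^-1.
have -> : a - 2 * b^-1 * k + b^-1 ^+ 2 * k * b = b^-1 * (a * b - k) by field.
by rewrite pmulr_rge0 ?invr_gt0 // subr_ge0.
Qed.

Lemma state_real x : B x -> star x = x -> complex.Im (phi x) = 0.
Proof.
move=> Bx sx; have := state_herm (cstar_sub1 hB) Bx.
rewrite star1 mul1r mulr1 sx; case: (phi x) => a b [] /= ?; lra.
Qed.

Lemma state_star x : B x -> complex.Re (phi (star x)) = complex.Re (phi x).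
Proof.
move=> Bx; have := state_herm (cstar_sub1 hB) Bx.
by rewrite star1 mul1r mulr1 => ->; case: (phi x).
Qed.

(** On the unit ball Cauchy-Schwarz against [1] gives [|phi x|^2 <= phi 1 * phi (x'x) <= phi 1]. The
    norm being one, [phi 1 >= 1]. *)
Lemma state1 : phi 1 = 1.
Proof.
have B1 := cstar_sub1 hB.
have := state_sqr_ge0 B1; rewrite star1 mul1r lecE /= => /andP[/eqP im0 re0].
have k1 : complex.Re (phi 1) <= 1.
  have := state_le1 B1 nrm1_le1; case: (phi 1) im0 re0 => a b /= -> a0.
  by rewrite expr0n addr0 sqrtr_sqr ger0_norm.
have [_ lub] := state_norm1 sphi.
have : (1 : R[i]) <= (Num.sqrt (complex.Re (phi 1)))%:C.
  apply: lub => _ [x [Bx x1] <-].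
  have {}x1 : nrm x <= 1 by rewrite -lecR -nrmE.
  suff : Normc.normc (phi x) <= Num.sqrt (complex.Re (phi 1)) by rewrite -lecR.
  have Bxx : B (star x * x) by apply: cstar_subM => //; exact: cstar_sub_star.
  have xx1 : complex.Re (phi (star x * x)) <= 1.
    apply: le_trans (state_le1 Bxx _).
      case: (phi _) => a b /=; apply: le_trans (ler_norm a) _.
      by rewrite -sqrtr_sqr ler_wsqrtr // lerDl sqr_ge0.
    by rewrite nrm_starM expr_le1 // nrm_ge0.
  have := cauchy_schwarz B1 Bx; rewrite star1 !mul1r => cs.
  rewrite -[leLHS]ger0_norm ?normc_nneg // -sqrtr_sqr ler_wsqrtr //.
  by apply: le_trans cs _; rewrite ler_piMr.
rewrite (lecR 1) => k1'.
have {}k1' : 1 <= complex.Re (phi 1).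
  rewrite -(sqr_sqrtr re0) -[leLHS](expr1n _ 2) ler_sqr ?nnegrE ?sqrtr_ge0 //.
by apply/eqP; rewrite eq_complex /= im0 eqxx andbT eq_le k1 k1'.
Qed.

End OneState.

(** The norm of a state is attained at the unit, which belongs to [B]. *)
Lemma state_restrict B f : cstar_subalgebra B -> state_on setT f -> state_on B f.
Proof.
move=> hB sf; have hT := subalgebra_setT; split.
- by move=> c x y _ _; exact: (state_linear sf).
- by move=> _ [y By <-]; apply: (state_ge0 sf); exists y.
- split=> [_ [x [Bx x1] <-]|t tub].
    by have [ub _] := state_norm1 sf; apply: ub; exists x.
  apply: tub; exists 1; last by rewrite (state1 hT sf) normr1.
  by split; [exact: cstar_sub1 | rewrite nrmE (lecR _ 1) nrm1_le1].
Qed.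

(** The element [w + d] is the square of a self-adjoint one for each [d > 0], so [f w + d >= 0].
    This links the cone [cpos] to the positivity of states. *)
Lemma state_cpos f w : state_on setT f -> cpos w -> 0 <= complex.Re (f w).
Proof.
move=> sf pw; have hT := subalgebra_setT.
rewrite -oppr_le0; apply: (@le0_eps _ _ 1) => d d0.
have [e [se ee _]] := cpos_sqrt pw d0.
have := @state_sqr_ge0 setT f sf e I; rewrite se ee (stateD sf) // /sca (stateZ hT sf) //.
by rewrite (state1 hT sf) mulr1 lecE => /andP[_]; rewrite raddfD /=; lra.
Qed.

End States.

(** * The gauge of the positive cone and the extension of states *)

Section Gauge.
Context {R : realType} {A : cstarAlgebra R}.
Hypothesis n1 : nrm (1 : A) = 1.
Implicit Types (x y z w u h : A) (t : R) (f : A -> R[i]).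

Definition sapart x : A := (2^-1)%:C *: (x + star x).

Lemma star_sapart x : star (sapart x) = sapart x.
Proof. by rewrite /sapart starZr starD starK addrC. Qed.

Lemma sapartD x y : sapart (x + y) = sapart x + sapart y.
Proof. by rewrite /sapart starD addrACA scalerDr. Qed.

Lemma sapartZ t x : sapart (t%:C *: x) = t%:C *: sapart x.
Proof. by rewrite /sapart starZr -scalerDr !scalerA mulrC. Qed.

Lemma sapart_id x : star x = x -> sapart x = x.
Proof.
move=> sx; rewrite /sapart sx -{1 2}(scale1r x) -scalerDl scalerA -(rmorph1 (real_complex R)).
rewrite -rmorphD -rmorphM /=.
by have -> : 2^-1 * (1 + 1) = 1 :> R by [lra]; rewrite scale1r.
Qed.

Lemma sapart_i x : star x = x -> sapart ('i%C *: x) = 0.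
Proof.
move=> sx; rewrite /sapart starZ conjE sx -scalerDl.
have -> : 'i%C + ('i%C)^*%C = 0 :> R[i].
  by apply/eqP; rewrite eq_complex /= addr0 subrr !eqxx.
by rewrite scale0r scaler0.
Qed.

Lemma nrm_sapart x : nrm (sapart x) <= nrm x.
Proof.
rewrite /sapart nrmZr ger0_norm //; have := nrmD x (star x).
rewrite nrm_star; lra.
Qed.

(** In spectral terms, the largest spectral value of the self-adjoint part of [x]. The set is
    nonempty and bounded below, as shown next, so that [inf] does not take its default value. *)
Definition gauge x : R := inf [set t | cpos (sca t - sapart x)].

Lemma gauge_lb x t : cpos (sca t - sapart x) -> - nrm x <= t.
Proof.
move=> tx; suff : 0 <= t + nrm x by lra.
apply: (@cpos_sca_ge0 R A) => //.
have := @cpos_nrm R A (- sapart x) (nrm x).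
rewrite starN star_sapart nrmN opprK => /(_ erefl (nrm_sapart x)) /(cposD tx).
by rewrite scaD [sca (nrm x) + _]addrC addrA subrK.
Qed.

Lemma gauge_has_lb x : has_lbound [set t | cpos (sca t - sapart x)].
Proof. by exists (- nrm x) => t; exact: gauge_lb. Qed.

Lemma gauge_le x t : cpos (sca t - sapart x) -> gauge x <= t.
Proof. by move=> tx; apply: ge_inf => //; exact: gauge_has_lb. Qed.

Lemma gauge_nonempty x : [set t | cpos (sca t - sapart x)] !=set0.
Proof. by exists (nrm x); apply: cpos_nrm (star_sapart x) (nrm_sapart x). Qed.

Lemma gauge_ge x s : (forall t, cpos (sca t - sapart x) -> s <= t) -> s <= gauge x.
Proof. by move=> H; apply: lb_le_inf; [exact: gauge_nonempty | exact: H]. Qed.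

Lemma gauge_le_nrm x : gauge x <= nrm x.
Proof. by apply: gauge_le; apply: cpos_nrm (star_sapart x) (nrm_sapart x). Qed.

Lemma gauge_sublinear : real_sublinear gauge.
Proof.
apply: sublin_le => [x y|t x t0].
  rewrite -lerBlDr; apply: gauge_ge => s sx.
  rewrite lerBlDl -lerBlDr; apply: gauge_ge => r ry.
  rewrite lerBlDr; apply: gauge_le.
  by rewrite scaD sapartD [sapart x + _]addrC opprD addrACA; exact: cposD.
rewrite -ler_pdivrMl //; apply: gauge_ge => s sx.
rewrite ler_pdivrMl //; apply: gauge_le.
by rewrite sapartZ scaM -scalerBr; apply: cposZ => //; exact: ltW.
Qed.

(** The gauge is at most [0] at [i x] and [- i x] for self-adjoint [x], so [f x] is real;
    [gauge 1 <= 1] and [gauge (- 1) <= -1] give [f 1 = 1]; Kaplansky's theorem gives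
    [gauge (- (y'y)) <= d] for all [d > 0], hence positivity. *)
Lemma state_of_gauge f : (forall c x y, f (c *: x + y) = c * f x + f y) ->
  (forall x, complex.Re (f x) <= gauge x) -> state_on setT f.
Proof.
move=> flin fle.
have f0 : f 0 = 0.
  have := flin 1 0 0; rewrite scaler0 addr0 mul1r => /eqP.
  by rewrite -subr_eq0 opprD addrA subrr sub0r oppr_eq0 => /eqP.
have fZ c x : f (c *: x) = c * f x by have := flin c x 0; rewrite !addr0 f0 addr0.
have fN x : f (- x) = - f x by rewrite -scaleN1r fZ mulN1r.
have f_im x : star x = x -> complex.Im (f x) = 0.
  move=> sx.
  have g y : sapart y = 0 -> complex.Re (f y) <= 0.
    move=> y0; apply: le_trans (fle y) _; apply: gauge_le.
    by rewrite y0 subr0; exact: cpos_sca.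
  have h1 := g _ (sapart_i sx).
  have /g : sapart (- ('i%C *: x)) = 0 by rewrite -scalerN sapart_i // starN sx.
  by move: h1; rewrite fN fZ; case: (f x) => a b /=; lra.
have f1 : f 1 = 1.
  have s1 := @star1 R A; apply/eqP; rewrite eq_complex f_im //= eqxx andbT eq_le.
  apply/andP; split; first by rewrite (le_trans (fle 1)) // (le_trans (gauge_le_nrm 1)) // n1.
  have : gauge (- 1) <= - 1.
    apply: gauge_le; rewrite sapart_id ?starN ?s1 // opprK -[X in cpos (_ + X)]sca1 -scaD addNr.
    exact: cpos_sca.
  by have := fle (- 1); rewrite fN; case: (f 1) => a b /=; lra.
have fbound x : Normc.normc (f x) <= nrm x.
  have [fx0|fx0] := eqVneq (f x) 0; first by rewrite fx0 Normc.normc0 nrm_ge0.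
  set n := Normc.normc (f x).
  have np : 0 < n.
    rewrite lt0r normc_nneg andbT; apply: contra_neq fx0; exact: Normc.eq0_normc.
  (* A rotation by a scalar of modulus one makes [f (c *: x)] equal to [|f x|], so a bound on real
     parts suffices. *)
  pose c := (n^-1)%:C * (f x)^*%C.
  have cc : Normc.normc c = 1.
    rewrite Normc.normcM normcE_real gtr0_norm ?invr_gt0 //.
    suff -> : Normc.normc (f x)^*%C = n by rewrite mulVf ?gt_eqF.
    by rewrite /n; case: (f x) => a b /=; rewrite sqrrN.
  have cf : complex.Re (c * f x) = n.
    rewrite /c -mulrA; have : n ^+ 2 = n * n by rewrite expr2.
    move: np; rewrite /n; case: (f x) => a b /=; rewrite sqr_sqrtr ?addr_ge0 ?sqr_ge0 //.
    set m := Num.sqrt _ => m0 mm; rewrite !mul0r subr0 !mulNr opprK -!expr2 mm.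
    by rewrite mulKf // gt_eqF.
  rewrite -cf -fZ; apply: le_trans (fle _) _; apply: le_trans (gauge_le_nrm _) _.
  by rewrite nrmZ cc mul1r.
split=> [//|_ [y _ <-]|].
  have sy : star (star y * y) = star y * y by rewrite starM starK.
  rewrite lecE f_im //= eqxx /= -oppr_le0; apply: (@le0_eps _ _ 1) => d d0.
  have : gauge (- (star y * y)) <= d.
    apply: gauge_le; rewrite sapart_id ?starN ?sy // opprK addrC.
    exact: cpos_starM.
  by have := fle (- (star y * y)); rewrite fN mul1r; case: (f _) => a b /=; lra.
split=> [_ [x [_ x1] <-]|t tub].
  rewrite (lecR _ 1); apply: le_trans (fbound x) _.
  by rewrite -lecR -nrmE.
apply: tub; exists 1; last by rewrite f1 normr1.
by split=> //; rewrite nrmE n1.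
Qed.

(** By [sqr_le_nrm] the gauge of [h^2] is [nrm h ^+ 2]. Taking for [L] the whole line through
    [(h^2, nrm h ^+ 2)] bounds [f (h^2)] from both sides. *)
Lemma exists_norming_state h : star h = h ->
  exists f, state_on setT f /\ f (h * h) = ((nrm h ^+ 2)%:C : R[i]).
Proof.
move=> sh; set n := nrm h ^+ 2; have sg := gauge_sublinear.
have shh : star (h * h) = h * h by rewrite starM sh.
have gn : gauge (h * h) = n.
  apply/eqP; rewrite eq_le; apply/andP; split.
    by apply: le_trans (gauge_le_nrm _) _; rewrite nrm_sa_sqr.
  by apply: gauge_ge => t; rewrite sapart_id //; exact: sqr_le_nrm.
pose L := [set vc : A * R | exists s : R, vc = (s%:C *: (h * h), s * n)].
have [||||f [flin fle fL]] := @hahn_banach_cone R A gauge L sg.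
- by exists 0; rewrite scale0r mul0r.
- move=> _ _ _ _ [s [-> ->]] [t [-> ->]]; exists (s + t).
  by rewrite rmorphD scalerDl mulrDl.
- move=> t _ _ _ [s [-> ->]]; exists (t * s).
  by rewrite rmorphM scalerA mulrA.
- move=> _ _ [s [-> ->]]; have [s0|s0|->] := ltgtP s 0; last first.
  + by rewrite scale0r oppr0 sublin0 // mul0r oppr0.
  + rewrite -scalerN (sublinZ sg) // -mulrN ler_pM2l //.
    by have := sublinN (h * h) sg; rewrite gn.
  + rewrite -scaleNr -rmorphN (sublinZ sg) ?gn; last lra.
    by rewrite mulNr opprK.
have sf := state_of_gauge flin fle.
exists f; split=> //; have hT := @subalgebra_setT R A.
have im0 : complex.Im (f (h * h)) = 0 by apply: (state_real hT sf).
apply/eqP; rewrite eq_complex /= im0 eqxx andbT eq_le; apply/andP; split.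
  by apply: fL; exists 1; rewrite scale1r mul1r.
have /fL : L ((-1)%:C *: (h * h), -1 * n) by exists (-1).
by rewrite (stateZ hT sf) //; case: (f _) => a b /=; lra.
Qed.

(** Hahn-Banach for the gauge, with [L] prescribing the real part on [A1 + A2]. Since [L] is a
    relation, no prior proof is required that [x1 + x2] determines the prescribed value. *)
Lemma common_state_extension (A1 A2 : set A) phi1 phi2 :
  cstar_subalgebra A1 -> cstar_subalgebra A2 ->
  state_on A1 phi1 -> state_on A2 phi2 ->
  (forall t x1 x2, A1 x1 -> A2 x2 -> star x1 = x1 -> star x2 = x2 ->
    cpos (sca t + (x1 + x2)) ->
    0 <= t + (complex.Re (phi1 x1) + complex.Re (phi2 x2))) ->
  exists phi, [/\ state_on setT phi, extends_on A1 phi phi1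
                & extends_on A2 phi phi2].
Proof.
move=> hA1 hA2 s1 s2 pos.
pose L := [set vc : A * R | exists x1 x2, [/\ A1 x1, A2 x2 &
  vc = (x1 + x2, complex.Re (phi1 x1) + complex.Re (phi2 x2))]].
have A0 B : cstar_subalgebra B -> B 0.
  by move=> hB; rewrite -(subrr 1); apply: cstar_subB => //; exact: cstar_sub1.
have sapartB B x : cstar_subalgebra B -> B x -> B (sapart x).
  move=> hB Bx; apply: cstar_subZ => //; apply: cstar_subD => //.
  exact: cstar_sub_star.
have re_sapart B phi x : cstar_subalgebra B -> state_on B phi -> B x ->
    complex.Re (phi (sapart x)) = complex.Re (phi x).
  move=> hB sB Bx; have Bs := cstar_sub_star hB Bx.
  rewrite /sapart (stateZ hB sB); last exact: cstar_subD.
  rewrite (stateD sB) //; have := state_star hB sB Bx.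
  by case: (phi x) (phi (star x)) => [a b] [a' b'] /=; lra.
have [||||f [flin fle fL]] := @hahn_banach_cone R A gauge L gauge_sublinear.
- exists 0, 0; split; [exact: A0|exact: A0|].
  by rewrite (state0 hA1 s1) (state0 hA2 s2) /= !addr0.
- move=> _ _ _ _ [x1 [x2 [B1 B2 [-> ->]]]] [y1 [y2 [C1 C2 [-> ->]]]].
  exists (x1 + y1), (x2 + y2); split; [exact: cstar_subD|exact: cstar_subD|].
  by rewrite (stateD s1) // (stateD s2) // !raddfD /= addrACA [X in (_, X)]addrACA.
- move=> t _ _ t0 [x1 [x2 [B1 B2 [-> ->]]]].
  exists (t%:C *: x1), (t%:C *: x2); split; [exact: cstar_subZ|exact: cstar_subZ|].
  rewrite (stateZ hA1 s1) // (stateZ hA2 s2) // scalerDr; congr (_, _).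
  by case: (phi1 x1) (phi2 x2) => [a b] [a' b'] /=; ring.
- move=> _ _ [x1 [x2 [B1 B2 [-> ->]]]]; rewrite lerNl; apply: gauge_ge => t.
  rewrite -scaleN1r -(rmorphN1 (real_complex R)) sapartZ rmorphN1 scaleN1r opprK sapartD.
  move=> tx; have := pos t _ _ (sapartB _ _ hA1 B1) (sapartB _ _ hA2 B2).
  rewrite !star_sapart (re_sapart _ _ _ hA1 s1) // (re_sapart _ _ _ hA2 s2) //.
  by move=> /(_ erefl erefl tx); lra.
have sf := state_of_gauge flin fle; have hT := @subalgebra_setT R A.
(* The inequality of real parts at [x] and [- x] is an equality; at [i x] it yields the imaginary
   parts. *)
have ext B phi : cstar_subalgebra B -> state_on B phi ->
    (forall x, B x -> complex.Re (f x) <= complex.Re (phi x)) -> extends_on B f phi.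
  move=> hB sB le x Bx.
  have re y : B y -> complex.Re (f y) = complex.Re (phi y).
    move=> By; apply/eqP; rewrite eq_le le //=.
    have := le _ (cstar_subZ hB (-1) By); rewrite (stateZ hT sf) // (stateZ hB sB) //.
    by rewrite !mulN1r !raddfN /=; lra.
  have := re _ Bx; have := re _ (cstar_subZ hB 'i%C Bx).
  rewrite (stateZ hT sf) // (stateZ hB sB) //.
  case: (f x) (phi x) => [a b] [c d] /= H1 H2.
  by apply/eqP; rewrite eq_complex /=; apply/andP; split; apply/eqP; lra.
exists f; split=> //; apply: ext => // x Bx; apply: fL.
  exists x, 0; split=> //; first exact: A0.
  by rewrite (state0 hA2 s2) /= !addr0.
exists 0, x; split=> //; first exact: A0.
by rewrite (state0 hA1 s1) /= !add0r.
Qed.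

End Gauge.

(** * Independence *)

Section Independence.
Context {R : realType} {A : cstarAlgebra R} {A1 A2 : set A}.
Hypotheses (hA1 : cstar_subalgebra A1) (hA2 : cstar_subalgebra A2).

Lemma state_le_sqrtC B (phi : A -> R[i]) z : cstar_subalgebra B ->
  state_on B phi -> cstar_pos B z -> phi z <= sqrtC (phi (z ^+ 2)).
Proof.
move=> hB sB pz; have z0 := state_ge0 sB pz.
have [y By yz] := pz.
have sz : star z = z by rewrite -yz starM starK.
have Bz : B z by rewrite -yz; apply: cstar_subM => //; exact: cstar_sub_star.
have zz0 : 0 <= phi (z ^+ 2) by have := state_sqr_ge0 sB Bz; rewrite sz expr2.
have := cauchy_schwarz hB sB (cstar_sub1 hB) Bz.
rewrite star1 !mul1r sz -expr2 (state1 hB sB) mul1r => cs.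
rewrite -[leLHS](sqrCK z0) ler_sqrtC ?nnegrE ?exprn_ge0 //.
have /complex_realP[a za] := ger0_real z0.
have /complex_realP[b zb] := ger0_real zz0.
rewrite za zb -rmorphXn lecR; move: cs.
by rewrite za zb normcE_real real_normK ?num_real.
Qed.

(** A state has the value [1] at the unit and is bounded by the norm; its existence excludes the
    zero algebra. *)
Lemma nrm1_of_state B (phi : A -> R[i]) : cstar_subalgebra B ->
  state_on B phi -> nrm (1 : A) = 1.
Proof.
move=> hB sB; apply/eqP; rewrite eq_le nrm1_le1 /=.
have := state_le_nrm hB sB (cstar_sub1 hB).
by rewrite (state1 hB sB) Normc.normc1.
Qed.

Lemma Re_le_normc (c : R[i]) : complex.Re c <= Normc.normc c.
Proof.
case: c => a b /=; apply: le_trans (ler_norm a) _.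
by rewrite -sqrtr_sqr ler_wsqrtr // lerDl sqr_ge0.
Qed.

Lemma state_shift_sqr B (phi : A -> R[i]) x (c : R) : cstar_subalgebra B ->
  state_on B phi -> B x -> complex.Re (phi ((sca c - x) * (sca c - x))) =
  c ^+ 2 - 2 * c * complex.Re (phi x) + complex.Re (phi (x * x)).
Proof.
move=> hB sB Bx; have B1 := cstar_sub1 hB; have BB := cstar_subB hB.
have BZ := cstar_subZ hB; have BM := cstar_subM hB.
rewrite mulrBl !mulrBr !scaMl scaMr /sca scalerA.
rewrite !(stateB hB sB) ?(stateZ hB sB) ?(state1 hB sB); auto.
by case: (phi x) (phi (x * x)) => [a ?] [b ?] /=; ring.
Qed.

(* With [b = 1 - a], Cauchy-Schwarz turns [phi (b^2) = 0] into [phi (b^4) = 0],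
   and then [psi (b^2) = 0] into [psi b = 0]. *)
Lemma state_transfer (phi psi : A -> R[i]) a : state_on A2 phi ->
  state_on setT psi -> cstar_pos A2 a -> nrm a = 1 -> phi a = 1 ->
  (forall z, cstar_pos A2 z -> psi z <= sqrtC (phi (z ^+ 2))) -> psi a = 1.
Proof.
move=> sphi spsi [y Ay ya] na phia dom.
have hT := @subalgebra_setT R A.
have sa : star a = a by rewrite -ya starM starK.
have Aa : A2 a by rewrite -ya; apply: cstar_subM => //; exact: cstar_sub_star.
have A2_1 := cstar_sub1 hA2; have AM := cstar_subM hA2; have AB := cstar_subB hA2.
set b := 1 - a; have Ab : A2 b by exact: AB.
have sb : star b = b by rewrite starB star1 sa.
have Re_aa : complex.Re (phi (a * a)) <= 1.
  have aa1 : nrm (a * a) <= 1 by rewrite nrm_sa_sqr // na expr1n.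
  exact: le_trans (Re_le_normc _) (state_le1 sphi (AM _ _ Aa Aa) aa1).
have Re_bb : complex.Re (phi (star b * b)) <= 0.
  rewrite sb mulrBl mul1r mulrBr mulr1 !(stateB hA2 sphi) ?phia ?(state1 hA2 sphi); auto.
  by move: Re_aa; case: (phi _) => c d /=; lra.
(* Cauchy-Schwarz for [b^3] and [b]: [|phi (b^4)|^2 <= phi (b^6) phi (b^2)], whose last factor is at
   most [0]. *)
have phibb : phi (b ^+ 2 ^+ 2) = 0.
  have := cauchy_schwarz hA2 sphi (AM _ _ Ab (AM _ _ Ab Ab)) Ab.
  have uu0 := state_sqr_ge0 sphi (AM _ _ Ab (AM _ _ Ab Ab)).
  have uu : 0 <= complex.Re (phi (star (b * (b * b)) * (b * (b * b)))).
    by move: uu0; rewrite lecE => /andP[].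
  move=> cs; apply: Normc.eq0_normc.
  have : Normc.normc (phi (star (b * (b * b)) * b)) ^+ 2 <= 0.
    by apply: le_trans cs _; rewrite mulr_ge0_le0.
  rewrite !starM sb !expr2 !mulrA => n0.
  apply/eqP; rewrite -sqrf_eq0 eq_le sqr_ge0 andbT expr2.
  by apply: le_trans n0.
have psibb : psi (star b * b) = 0.
  apply/eqP; rewrite eq_le (state_sqr_ge0 spsi) // andbT sb -expr2.
  apply: le_trans (dom _ _) _; first by exists b; rewrite ?sb // expr2.
  by rewrite phibb sqrtC0.
have psib : psi b = 0.
  have := @cauchy_schwarz R A setT psi hT spsi 1 b I I.
  rewrite psibb mulr0 star1 !mul1r => n0.
  apply: Normc.eq0_normc; apply/eqP; rewrite -sqrf_eq0 eq_le sqr_ge0 andbT.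
  exact: n0.
have -> : a = 1 - b by rewrite /b opprB addrC subrK.
by rewrite (stateB hT spsi) // psib (state1 hT spsi) subr0.
Qed.

Definition domination_property : Prop :=
  forall (a1 a2 : A) (phi1 phi2 : A -> R[i]),
     cstar_pos A1 a1 -> `|a1| = 1 -> cstar_pos A2 a2 -> `|a2| = 1 ->
     state_on A1 phi1 -> state_on A2 phi2 -> phi1 a1 = 1 -> phi2 a2 = 1 ->
     exists psi1 psi2 : A -> R[i],
       [/\ state_on setT psi1 /\ extends_on A1 psi1 phi1,
           state_on setT psi2 /\ extends_on A2 psi2 phi2,
           (forall z, cstar_pos A2 z -> psi1 z <= sqrtC (phi2 (z ^+ 2)))
         & (forall z, cstar_pos A1 z -> psi2 z <= sqrtC (phi1 (z ^+ 2)))].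

(** States of [A] norming [h1^2] and [h2^2] restrict to states of [A1] and [A2]. The extension of
    the first keeps its value at [h1^2] and, by [state_transfer], is [1] at [h2^2]. *)
Lemma common_norming_state h1 h2 : nrm (1 : A) = 1 -> domination_property ->
  A1 h1 -> A2 h2 -> star h1 = h1 -> star h2 = h2 -> nrm h1 = 1 -> nrm h2 = 1 ->
  exists psi : A -> R[i],
    [/\ state_on setT psi, psi (h1 * h1) = 1 & psi (h2 * h2) = 1].
Proof.
move=> n1 dom A1h A2h s1 s2 nh1 nh2.
have [f1 [sf1 fh1]] := exists_norming_state n1 s1.
have [f2 [sf2 fh2]] := exists_norming_state n1 s2.
have p1 : cstar_pos A1 (h1 * h1) by exists h1; rewrite ?s1.
have p2 : cstar_pos A2 (h2 * h2) by exists h2; rewrite ?s2.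
have nn1 : nrm (h1 * h1) = 1 by rewrite nrm_sa_sqr // nh1 expr1n.
have nn2 : nrm (h2 * h2) = 1 by rewrite nrm_sa_sqr // nh2 expr1n.
have sr1 := state_restrict hA1 sf1; have sr2 := state_restrict hA2 sf2.
rewrite nh1 expr1n in fh1; rewrite nh2 expr1n in fh2.
have [||psi [psi2 [[spsi e1] _ dom1 _]]] := dom _ _ _ _ p1 _ p2 _ sr1 sr2 fh1 fh2.
- by rewrite nrmE nn1.
- by rewrite nrmE nn2.
exists psi; split=> //; last exact: state_transfer sr2 spsi p2 nn2 fh2 dom1.
by rewrite e1 //; exact: cstar_subM.
Qed.

(* Apply the hypothesis to the normalisations of [c - x1] and [c - x2]: the
   state [psi] attains the norm of [(c - xi)^2], so it exceeds [phii] there, and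
   dividing by [2 c] gives [psi xi <= phii xi + O(1 / c)]. *)
Lemma states_compatible (phi1 phi2 : A -> R[i]) :
  (forall h1 h2, A1 h1 -> A2 h2 -> star h1 = h1 -> star h2 = h2 ->
    nrm h1 = 1 -> nrm h2 = 1 -> exists psi : A -> R[i],
    [/\ state_on setT psi, psi (h1 * h1) = 1 & psi (h2 * h2) = 1]) ->
  state_on A1 phi1 -> state_on A2 phi2 ->
  forall t x1 x2, A1 x1 -> A2 x2 -> star x1 = x1 -> star x2 = x2 ->
    cpos (sca t + (x1 + x2)) ->
    0 <= t + (complex.Re (phi1 x1) + complex.Re (phi2 x2)).
Proof.
move=> norming s1 s2 t x1 x2 B1 B2 sx1 sx2 pos.
have hT := @subalgebra_setT R A.
have n1 := nrm1_of_state hA1 s1.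
rewrite -oppr_le0.
apply: (@le0_eps _ _ (nrm x1 ^+ 2 + nrm x2 ^+ 2)) => e e0.
(* Larger than both norms, so that [c - x1] and [c - x2] are nonzero and can be normalised; at least
   [1 / e], so that the error, of order [1 / c], is at most a constant times [e]. *)
pose c := e^-1 + nrm x1 + nrm x2 + 1.
have ei : 0 < e^-1 by rewrite invr_gt0.
have k1 := nrm_ge0 x1; have k2 := nrm_ge0 x2.
have npos (x : A) : nrm x < c -> 0 < nrm (sca c - x).
  move=> xc; have := nrmD (sca c - x) x; rewrite subrK [nrm (sca c)]nrmZr n1 mulr1.
  by have := ler_norm c; lra.
have np1 : 0 < nrm (sca c - x1) by apply: npos; rewrite /c; lra.
have np2 : 0 < nrm (sca c - x2) by apply: npos; rewrite /c; lra.
pose unit (h : A) : A := (nrm h)^-1%:C *: h.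
have unit1 (h : A) : 0 < nrm h -> nrm (unit h) = 1.
  by move=> h0; rewrite nrmZr gtr0_norm ?invr_gt0 // mulVf ?gt_eqF.
have unit_sa (x : A) : star x = x -> star (unit (sca c - x)) = unit (sca c - x).
  by move=> sx; rewrite starZr starB star_sca sx.
have unitB (B : set A) x : cstar_subalgebra B -> B x -> B (unit (sca c - x)).
  move=> hB Bx; apply: cstar_subZ => //; apply: cstar_subB => //.
  exact: cstar_sub_sca.
have [psi [spsi q1 q2]] := norming _ _ (unitB _ _ hA1 B1)
  (unitB _ _ hA2 B2) (unit_sa _ sx1) (unit_sa _ sx2) (unit1 _ np1) (unit1 _ np2).
(* Expanding [psi ((c - x)^2) = nrm (c - x) ^+ 2 >= phi ((c - x)^2)] leaves [2 c (psi x - phi x) <=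
   psi (x^2) - phi (x^2) <= nrm x ^+ 2]. *)
have key (B : set A) phi x : cstar_subalgebra B -> state_on B phi -> B x -> star x = x ->
    0 < nrm (sca c - x) -> psi (unit (sca c - x) * unit (sca c - x)) = 1 ->
    2 * c * (complex.Re (psi x) - complex.Re (phi x)) <= nrm x ^+ 2.
  move=> hB sB Bx sx np; rewrite /unit scAl scAr scalerA -rmorphM /= (stateZ hT spsi) //.
  move=> /(congr1 (@complex.Re R)); have shh : star (sca c - x) = sca c - x.
    by rewrite starB star_sca sx.
  have Bc : B (sca c - x) by apply: cstar_subB => //; exact: cstar_sub_sca.
  have nphi := state_le_nrm hB sB (cstar_subM hB Bc Bc).
  have {nphi} := le_trans (Re_le_normc _) nphi; rewrite nrm_sa_sqr //.
  have psi_xx := state_le_nrm hT spsi (I : setT (x * x)).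
  have {psi_xx} := le_trans (Re_le_normc _) psi_xx; rewrite nrm_sa_sqr //.
  have : 0 <= complex.Re (phi (x * x)).
    by have := state_sqr_ge0 sB Bx; rewrite sx lecE => /andP[].
  have -> (z : R[i]) : complex.Re (((nrm (sca c - x))^-1 * (nrm (sca c - x))^-1)%:C * z)
      = (nrm (sca c - x) ^+ 2)^-1 * complex.Re z.
    by case: z => z z' /=; rewrite mul0r subr0 -invfM -expr2.
  rewrite (state_shift_sqr c hB sB Bx) (state_shift_sqr c hT spsi I) /=.
  set n := nrm (sca c - x) ^+ 2 => h1 h2 h3 /eqP.
  have n0 : n != 0 by rewrite expf_neq0 // gt_eqF.
  by rewrite -(inj_eq (mulfI n0)) mulrA mulfV // mul1r mulr1 => /eqP; lra.
have := key _ _ _ hA1 s1 B1 sx1 np1 q1.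
have := key _ _ _ hA2 s2 B2 sx2 np2 q2.
have := state_cpos spsi pos.
rewrite !(stateD spsi) // (stateZ hT spsi) // (state1 hT spsi) mulr1.
have ee : e^-1 * e = 1 by rewrite mulVf ?gt_eqF.
have ce : e^-1 <= 2 * c by rewrite /c; lra.
case: (psi x1) (psi x2) (phi1 x1) (phi2 x2) => [a1 ?] [a2 ?] [b1 ?] [b2 ?] /=.
move: (2 * c) ce => C ce H1 H2 H3.
set K := _ + nrm x2 ^+ 2; have K0 : 0 <= K by rewrite addr_ge0 ?sqr_ge0.
pose D := a1 + a2 - (b1 + b2).
suff : D <= K * e by rewrite /D; lra.
have CD : C * D <= K by rewrite /D /K; lra.
have [D0|D0] := leP D 0; first by rewrite (le_trans D0) // mulr_ge0 // ltW.
have : e^-1 * D <= C * D by rewrite ler_pM2r.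
move=> /le_trans/(_ CD); rewrite -(ler_pM2r e0) mulrAC ee mul1r.
by [].
Qed.

End Independence.

Theorem corollary3p2 (R : realType) (A : cstarAlgebra R) (A1 A2 : set A)
    (hA1 : cstar_subalgebra A1) (hA2 : cstar_subalgebra A2) :
  cstar_independent A1 A2 <->
  (forall (a1 a2 : A) (phi1 phi2 : A -> R[i]),
     cstar_pos A1 a1 -> `|a1| = 1 -> cstar_pos A2 a2 -> `|a2| = 1 ->
     state_on A1 phi1 -> state_on A2 phi2 -> phi1 a1 = 1 -> phi2 a2 = 1 ->
     exists psi1 psi2 : A -> R[i],
       [/\ state_on setT psi1 /\ extends_on A1 psi1 phi1,
           state_on setT psi2 /\ extends_on A2 psi2 phi2,
           (forall z, cstar_pos A2 z -> psi1 z <= sqrtC (phi2 (z ^+ 2)))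
         & (forall z, cstar_pos A1 z -> psi2 z <= sqrtC (phi1 (z ^+ 2)))]).
Proof.
have hT := @subalgebra_setT R A.
split=> [ind a1 a2 phi1 phi2 _ _ _ _ s1 s2 _ _|dom phi1 phi2 s1 s2].
  have [phi [sphi e1 e2]] := ind _ _ s1 s2.
  have posT (B : set A) z : cstar_pos B z -> cstar_pos (setT : set A) z.
    by move=> [y _ yz]; exists y.
  have sqr (B : set A) z : cstar_subalgebra B -> cstar_pos B z -> B (z ^+ 2).
    move=> hB [y By <-]; rewrite expr2.
    by do 2 (apply: cstar_subM => //; try exact: cstar_sub_star).
  exists phi, phi; split=> // z pz.
    by rewrite -(e2 _ (sqr _ _ hA2 pz)); apply: (state_le_sqrtC hT) (posT _ _ pz).
  by rewrite -(e1 _ (sqr _ _ hA1 pz)); apply: (state_le_sqrtC hT) (posT _ _ pz).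
apply: common_state_extension => //; first exact: nrm1_of_state s1.
apply: states_compatible => // h1 h2.
exact: common_norming_state (nrm1_of_state hA1 s1) dom.
Qed.
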